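(* For every integer $k\ge0$, the tree $F_k$ has order $\Theta(k^2)$, $\operatorname{bdim}(F_k)=O(k)$, and $\operatorname{adim}(F_k)=\Theta(k^2)$.
   Context: For $k\ge0$, $L_k$ is the path $v_0,v_1,\dots,v_k$, and $F_k$ is the tree obtained from $L_k$ by attaching, for each $1\le i\le k$, a path on $i$ vertices with one endpoint joined by an edge to $v_i$. $d(u,v)$ is graph distance and $d_k(u,v)=\min\{d(u,v),k+1\}$. A function $f:V(G)\to\mathbb{Z}_{\ge0}$ is a resolving broadcast of $G$ if for any distinct $x,y$ there is $z$ with $f(z)>0$ and $d_{f(z)}(x,z)\ne d_{f(z)}(y,z)$; $\operatorname{bdim}(G)$ is the minimum of $\sum_v f(v)$ over resolving broadcasts. A set $A\subseteq V(G)$ is an adjacency resolving set if for any distinct $x,y$ there is $z\in A$ with $d_1(x,z)\ne d_1(y,z)$; $\operatorname{adim}(G)$ is the minimum size of such a set. *)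

(* Defs.v *)
From mathcomp Require Import all_boot.
From mathcomp Require Import zify boolp.

Set Implicit Arguments.
Unset Strict Implicit.
Unset Printing Implicit Defensive.

Record sgraph := SGraph {
  vertex :> finType;
  adj : rel vertex;
  adj_sym : symmetric adj;
  adj_irr : irreflexive adj }.

Section Graph.
Variable G : sgraph.

Definition connected_graph := forall x y : G, connect (@adj G) x y.

Definition acyclic_graph :=
  forall c : seq G, ucycle (@adj G) c -> size c <= 2.

Definition is_tree := connected_graph /\ acyclic_graph.

Definition walk (n : nat) (x y : G) : bool :=
  [exists p : n.-tuple G, path (@adj G) x p && (last x p == y)].

(* A shortest walk has length < #|G|, so the search range suffices; the value
   is #|G| when no walk joins x to y. *)
Definition dist (x y : G) : nat :=
  find (fun n => walk n x y) (iota 0 #|G|).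

Definition tdist (k : nat) (x y : G) : nat := minn (dist x y) k.+1.

Definition resolving_broadcast (f : G -> nat) : bool :=
  [forall x, forall y, (x != y) ==>
    [exists z, (0 < f z) && (tdist (f z) x z != tdist (f z) y z)]].

Definition adj_resolving (A : {set G}) : bool :=
  [forall x, forall y, (x != y) ==>
    [exists z in A, tdist 1 x z != tdist 1 y z]].

Lemma card_vertex_gt0 (x : G) : 0 < #|G|.
Proof. by apply/card_gt0P; exists x. Qed.

Lemma dist_xx (x : G) : dist x x = 0.
Proof.
rewrite /dist; case: #|G| (card_vertex_gt0 x) => // n _ /=.
by case: ifP => // /existsP[]; exists [tuple]; rewrite /= eqxx.
Qed.

Lemma dist_gt0 (x y : G) : x != y -> 0 < dist x y.
Proof.
move=> xy; rewrite /dist; case: #|G| (card_vertex_gt0 x) => // n _ /=.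
case: ifP => // /existsP[p]; rewrite tuple0 /= => xy'.
by rewrite xy' in xy.
Qed.

Lemma tdist_self_neq (x y : G) : x != y -> tdist 1 x x != tdist 1 y x.
Proof.
by move=> xy; rewrite /tdist dist_xx min0n eq_sym -lt0n leq_min dist_gt0 // eq_sym.
Qed.

Lemma resolving_broadcast1 : resolving_broadcast (fun=> 1).
Proof.
apply/forallP => x; apply/forallP => y; apply/implyP => xy.
by apply/existsP; exists x; rewrite /= tdist_self_neq.
Qed.

Lemma adj_resolvingT : adj_resolving [set: G].
Proof.
apply/forallP => x; apply/forallP => y; apply/implyP => xy.
by apply/existsP; exists x; rewrite in_setT tdist_self_neq.
Qed.

Definition has_broadcast (n : nat) : bool :=
  `[< exists f : G -> nat, resolving_broadcast f /\ \sum_v f v = n >].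

Lemma has_broadcast_ex : exists n, has_broadcast n.
Proof.
exists (\sum_(v : G) 1); apply/asboolP; exists (fun=> 1); split=> //.
exact: resolving_broadcast1.
Qed.

Definition bdim : nat := ex_minn has_broadcast_ex.

Definition has_adj_resolving (n : nat) : bool :=
  [exists A : {set G}, adj_resolving A && (#|A| == n)].

Lemma has_adj_resolving_ex : exists n, has_adj_resolving n.
Proof.
exists #|[set: G]|; apply/existsP; exists [set: G].
by rewrite adj_resolvingT /=.
Qed.

Definition adim : nat := ex_minn has_adj_resolving_ex.

End Graph.

Section Fk.
Variable k : nat.

(* The pair (i, j) with j <= i <= k stands for v_i when j = 0, and for the j-th
   vertex, counted from v_i, of the path attached to v_i when j > 0. *)
Definition F_vertex : finType := {i : 'I_k.+1 & 'I_i.+1}.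

Definition consec (m n : nat) : bool := (n == m.+1) || (m == n.+1).

Definition F_adj (x y : F_vertex) : bool :=
  let i := nat_of_ord (tag x) in let j := nat_of_ord (tagged x) in
  let i' := nat_of_ord (tag y) in let j' := nat_of_ord (tagged y) in
  [&& j == 0, j' == 0 & consec i i'] || (i == i') && consec j j'.

Lemma F_adj_sym : symmetric F_adj.
Proof.
by move=> x y; rewrite /F_adj /consec; apply/idP/idP; lia.
Qed.

Lemma F_adj_irr : irreflexive F_adj.
Proof.
by move=> x; rewrite /F_adj /consec !orbb !(ltn_eqF (ltnSn _)) !andbF.
Qed.

Definition F : sgraph := SGraph F_adj_sym F_adj_irr.

Lemma F_vertex_inj (x y : F) :
  tag x = tag y :> nat -> tagged x = tagged y :> nat -> x = y.
Proof.
case: x y => [i j] [i' j'] /= /ord_inj ei; case: i' / ei j' => j' /ord_inj ej.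
by rewrite ej.
Qed.

Lemma F_connected : connected_graph F.
Proof.
have root (x : F) : connect F_adj (Tagged (fun i : 'I_k.+1 => 'I_i.+1) (ord0 : 'I_(@ord0 k).+1)) x.
  case: x => [i [j ltji]]; elim: j ltji => [|j IH] ltji; last first.
    apply: connect_trans (IH (ltnW ltji)) (connect1 _).
    by rewrite /F_adj /consec /= !eqxx orbT.
  case: i ltji => i lti; elim: i lti => [|i IH] lti lt0i.
    rewrite -[X in connect _ _ X](@F_vertex_inj (Tagged (fun i : 'I_k.+1 => 'I_i.+1) (ord0 : 'I_(@ord0 k).+1))) //.
  apply: connect_trans (IH (ltnW lti) isT) (connect1 _).
  by rewrite /F_adj /consec /= !eqxx.
move=> x y; apply: connect_trans (root y).
by rewrite (sym_connect_sym F_adj_sym).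
Qed.

Lemma F_acyclic : acyclic_graph F.
Proof.
pose rk (x : F) := tag x + tagged x.
have parent (x y z : F) : F_adj x y -> F_adj x z ->
    rk y <= rk x -> rk z <= rk x -> y = z.
  rewrite /F_adj /consec /rk => xy xz ry rz.
  by apply: F_vertex_inj; move: xy xz ry rz; lia.
case=> [//|x0 c0]; set c := x0 :: c0 => /andP[cyc unc].
have [x xc xmax] : exists2 x, x \in c & forall y, y \in c -> rk y <= rk x.
  have x0c : x0 \in c by rewrite mem_head.
  by case: (arg_maxnP rk x0c) => x xc xmax; exists x.
have [i p cE] := rot_to xc.
rewrite -(size_rot i) cE.
have memE y : y \in x :: p -> rk y <= rk x.
  by rewrite -cE mem_rot; apply: xmax.
move: cyc unc; rewrite -(rot_cycle i) -(rot_uniq i) cE {cE}.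
case: p memE => [//|y q]; case/lastP: q => [//|q z] memE.
rewrite /= !rcons_path !last_rcons => /and3P[xy _ zx] /and3P[_ + _].
rewrite (parent x y z) ?mem_rcons ?mem_head // ?memE //.
- by rewrite F_adj_sym.
- by rewrite !inE eqxx orbT.
- by rewrite !inE mem_rcons mem_head !orbT.
Qed.

Lemma F_tree : is_tree F.
Proof. by split; [exact: F_connected | exact: F_acyclic]. Qed.

End Fk.

(* Main.v *)
Require Import Defs.
From mathcomp Require Import all_boot all_order all_algebra.
From mathcomp Require Import zify.
From mathcomp Require Import all_classical all_reals topology normedtype landau.
Import numFieldNormedType.Exports.

(** Upper bound on [bdim]: the distances from the vertex [(i, j)] to [v_0] and
    to [v_k] are [i + j] and [k - i + j], which together determine [i] and [j];
    so the broadcast giving [v_0] and [v_k] a strength exceeding all these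
    distances resolves, at a cost linear in [k].

    Lower bound on [adim]: two vertices that are both outside the closed
    neighbourhood of [A] look the same from every [z \in A], hence an adjacency
    resolving set dominates all vertices but at most one; as degrees are
    bounded, its size is at least proportional to the order. *)

(** * Distances and adjacency resolving sets in an arbitrary graph *)

Section Graph.
Variable G : sgraph.

Lemma walkS n (x y : G) :
  walk n.+1 x y = [exists z, adj x z && walk n z y].
Proof.
apply/existsP/existsP => [[p]|[z /andP[xz /existsP[p pP]]]].
  case/tupleP: p => z p /= /andP[/andP[xz zp] py].
  by exists z; rewrite xz; apply/existsP; exists p; rewrite zp.
by exists [tuple of z :: p]; rewrite /= xz.
Qed.

Lemma walk0 (x y : G) : walk 0 x y = (x == y).
Proof.
apply/existsP/idP => [[p]|xy]; first by rewrite tuple0.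
by exists [tuple].
Qed.

Lemma adj_walk1 (x y : G) : walk 1 x y = adj x y.
Proof.
rewrite walkS; apply/existsP/idP => [[z]|xy].
  by rewrite walk0 => /andP[xz /eqP <-].
by exists y; rewrite xy walk0 eqxx.
Qed.

(** Along a walk to [z] the potential drops by at most one per edge, so no walk is shorter than
    [phi x]; descending one unit at a time gives a walk of exactly that length. The bound by [#|G|]
    keeps this length in the search range of [dist]. *)
Lemma dist_potential (z : G) (phi : G -> nat) :
  phi z = 0 ->
  (forall x y, adj x y -> phi x <= (phi y).+1) ->
  (forall x, x != z -> exists2 y, adj x y & phi x = (phi y).+1) ->
  forall x, phi x < #|G| -> dist x z = phi x.
Proof.
move=> phiz lip desc x ltx.
have lower n y : walk n y z -> phi y <= n.
  elim: n y => [|n IH] y; first by rewrite walk0 => /eqP->; rewrite phiz.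
  rewrite walkS => /existsP[t /andP[/lip yt /IH tn]]; lia.
have upper n y : phi y = n -> walk n y z.
  elim: n y => [|n IH] y yn; have [yz|/desc[t yt e]] := eqVneq y z.
  - by rewrite walk0 yz.
  - by rewrite e in yn.
  - by rewrite yz phiz in yn.
  - by rewrite walkS; apply/existsP; exists t; rewrite yt IH //; lia.
rewrite /dist; set d := find _ _.
have [dx|xd|//] := ltngtP d (phi x).
  have dG : d < #|G| := ltn_trans dx ltx.
  have := @nth_find _ 0 (fun n => walk n x z) (iota 0 #|G|).
  rewrite has_find size_iota -/d => /(_ dG); rewrite nth_iota // => /lower.
  by rewrite add0n leqNgt dx.
have := @before_find _ 0 (fun n => walk n x z) (iota 0 #|G|) (phi x) xd.
by rewrite nth_iota // add0n upper.
Qed.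

Lemma tdist1_far (x z : G) : x != z -> ~~ adj x z -> tdist 1 x z = 2.
Proof.
move=> xz nadj; apply/minn_idPr; rewrite ltnNge; apply/negP => d1.
have dE : dist x z = 1 by apply/eqP; rewrite eqn_leq d1 dist_gt0.
(* With two distinct vertices, 1 lies in the search range, so the value 1 of [dist] comes from an
   actual walk and is not the default. *)
have lt1G : 1 < #|G| by rewrite (cardD1 x) (cardD1 z) !inE eq_sym xz.
have := @nth_find _ 0 (fun n => walk n x z) (iota 0 #|G|).
rewrite has_find size_iota -/(dist x z) dE nth_iota // => /(_ lt1G).
by rewrite adj_walk1 (negPf nadj).
Qed.

Definition dominated (A : {set G}) : {set G} :=
  \bigcup_(z in A) [set x | (x == z) || adj x z].

Lemma adj_resolving_dominated (A : {set G}) :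
  adj_resolving A -> #|~: dominated A| <= 1.
Proof.
move=> resA; have far x z : x \notin dominated A -> z \in A -> tdist 1 x z = 2.
  move=> ndx zA; have: ~~ ((x == z) || adj x z).
    by apply: contra ndx => xz; apply/bigcupP; exists z; rewrite // inE.
  by rewrite negb_or => /andP[? ?]; apply: tdist1_far.
apply/card_le1_eqP => x y; rewrite !inE => ndx ndy.
apply/eqP/idPn => yx.
have /forallP/(_ y)/forallP/(_ x)/implyP/(_ yx)/existsP[z /andP[zA]] := resA.
by rewrite !far // eqxx.
Qed.

Lemma card_dominated (A : {set G}) d :
  (forall z : G, #|[set x | (x == z) || adj x z]| <= d) ->
  #|dominated A| <= d * #|A|.
Proof.
move=> degG; apply: (@leq_trans (\sum_(z in A) d)); last first.
  by rewrite sum_nat_const mulnC.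
rewrite /dominated; elim/big_rec2: _ => [|z m B _ IH]; first by rewrite cards0.
by rewrite (leq_trans (leq_card_setU _ _)) // leq_add.
Qed.

Lemma adim_lower d :
  (forall z : G, #|[set x | (x == z) || adj x z]| <= d) ->
  #|G| <= d * adim G + 1.
Proof.
move=> degG; rewrite /adim; case: ex_minnP => n /existsP[A /andP[resA /eqP<-]] _.
(* The summand 1 pays for the possible undominated vertex. *)
by rewrite -(cardsC (dominated A)) leq_add ?card_dominated ?adj_resolving_dominated.
Qed.

Lemma adim_le_card : adim G <= #|G|.
Proof.
rewrite /adim; case: ex_minnP => n _; apply.
by apply/existsP; exists [set: G]; rewrite adj_resolvingT cardsT /=.
Qed.

Lemma bdim_le (f : G -> nat) : resolving_broadcast f -> bdim G <= \sum_v f v.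
Proof.
by move=> rf; rewrite /bdim; case: ex_minnP => n _; apply; apply/asboolP; exists f.
Qed.

End Graph.

(** * Order, distances and degrees in the tree *)

Section Fk.
Variable k : nat.

Lemma card_F : #|F k| * 2 = k.+1 * k.+2.
Proof.
rewrite [#|_|](@tagnat.card k.+1 (fun i => (nat_of_ord i).+1)).
elim: k => [|n IH]; first by rewrite big_ord1.
by rewrite big_ord_recr /= mulnDl IH; lia.
Qed.

(** Both potentials used below are at most [k.*2], so this places them in the search range of
    [dist]. *)
Lemma card_F_gt : k.*2 < #|F k|.
Proof. by have := card_F; case: k => [|n] //; nia. Qed.

Definition spine (x : F k) : nat := tag x.
Definition height (x : F k) : nat := tagged x.

Lemma F_adjE (x y : F k) :
  adj x y = [&& height x == 0, height y == 0 & consec (spine x) (spine y)]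
            || (spine x == spine y) && consec (height x) (height y).
Proof. by []. Qed.

Lemma spine_height_inj (x y : F k) :
  spine x = spine y -> height x = height y -> x = y.
Proof. exact: F_vertex_inj. Qed.

Lemma F_vertex_ex i j :
  j <= i -> i <= k -> exists x : F k, spine x = i /\ height x = j.
Proof.
rewrite -ltnS => ji; rewrite -ltnS => ik.
by exists (Tagged (fun i : 'I_k.+1 => 'I_i.+1) (Ordinal ji : 'I_(Ordinal ik).+1)).
Qed.

Lemma F_bounds (x : F k) : height x <= spine x <= k.
Proof. by case: x => [[i ik] [j ji]] /=; rewrite -ltnS ji -ltnS. Qed.

Lemma F_dist_v0 (x v0 : F k) :
  spine v0 = 0 -> dist x v0 = spine x + height x.
Proof.
move=> v0i; have v0j := F_bounds v0.
apply: (@dist_potential _ _ (fun y : F k => spine y + height y)).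
- by move: v0j; lia.
- by move=> y z; rewrite F_adjE /consec; lia.
- move=> y yv0.
  have yij : 0 < spine y + height y.
    rewrite lt0n; apply: contra yv0 => y0.
    by apply/eqP/spine_height_inj; move: y0 v0j; lia.
  (* From a spine vertex the descent moves towards [v0]; from any other vertex it moves down the
     attached path. *)
  have [j0|j0] := posnP (height y).
    have [||z [zi zj]] := @F_vertex_ex (spine y).-1 0; [lia| |].
      by have := F_bounds y; lia.
    by exists z; rewrite ?F_adjE /consec; lia.
  have [||z [zi zj]] := @F_vertex_ex (spine y) (height y).-1.
  + by have := F_bounds y; lia.
  + by have := F_bounds y; lia.
  by exists z; rewrite ?F_adjE /consec; lia.
- by have := F_bounds x; have := card_F_gt; lia.
Qed.

Lemma F_dist_vk (x vk : F k) :
  spine vk = k -> height vk = 0 ->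
  dist x vk = k - spine x + height x.
Proof.
move=> vki vkj.
apply: (@dist_potential _ _ (fun y : F k => k - spine y + height y)).
- lia.
- by move=> y z; rewrite F_adjE /consec; lia.
- move=> y yvk; have yb := F_bounds y.
  have yij : (spine y < k) || (0 < height y).
    rewrite -[_ || _]negbK; apply: contra yvk => y0.
    by apply/eqP/spine_height_inj; move: y0 yb; lia.
  have [j0|j0] := posnP (height y).
    have [||z [zi zj]] := @F_vertex_ex (spine y).+1 0; [lia|lia|].
    by exists z; rewrite ?F_adjE /consec; lia.
  have [||z [zi zj]] := @F_vertex_ex (spine y) (height y).-1; [lia|lia|].
  by exists z; rewrite ?F_adjE /consec; lia.
- by have := F_bounds x; have := card_F_gt; lia.
Qed.

Lemma bdim_F : bdim (F k) <= 4 * k + 2.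
Proof.
have [v0 [v0i v0j]] := @F_vertex_ex 0 0 (leqnn 0) (leq0n k).
have [vk [vki vkj]] := @F_vertex_ex k 0 (leq0n k) (leqnn k).
(* Strength [k.*2.+1] exceeds all distances to [v0] and [vk], so truncation never acts. Adding the
   two indicators keeps the total at [4 * k + 2] even when [k = 0], where [v0] and [vk] coincide. *)
pose f (v : F k) := k.*2.+1 * ((v == v0) + (v == vk)).
suff rf : resolving_broadcast f.
  suff <- : \sum_v f v = 4 * k + 2 by exact: bdim_le.
  have sum1 (u : F k) : \sum_v (v == u) = 1.
    by rewrite (bigD1 u) //= eqxx big1 // => v /negPf->.
  by rewrite -big_distrr big_split /= !sum1; lia.
have tdistE x z : f z > 0 -> dist x z <= k.*2 -> tdist (f z) x z = dist x z.
  by rewrite muln_gt0 /= /tdist => /(leq_mul (leqnn k.*2.+1)); rewrite -/(f z); lia.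
have f0 : 0 < f v0 by rewrite /f eqxx.
have fk : 0 < f vk by rewrite /f eqxx addn1.
apply/forallP => x; apply/forallP => y; apply/implyP => xy.
have xb := F_bounds x; have yb := F_bounds y.
have [e|ne] := eqVneq (tdist (f v0) x v0) (tdist (f v0) y v0); last first.
  by apply/existsP; exists v0; rewrite f0.
apply/existsP; exists vk; rewrite fk; apply: contra xy => /eqP.
have d0 u := @F_dist_v0 u v0 v0i; have dk u := @F_dist_vk u vk vki vkj.
move: e; rewrite !tdistE ?d0 ?dk //; try lia.
by move=> e1 e2; apply/eqP/spine_height_inj; lia.
Qed.

(* A neighbour is determined by its direction; the fifth value is for [z]. *)
Lemma F_closed_neighbourhood (z : F k) :
  #|[set x | (x == z) || adj x z]| <= 5.
Proof.
pose dir (x : F k) : 'I_5 :=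
  if spine x < spine z then inord 0 else if spine z < spine x then inord 1 else
  if height x < height z then inord 2 else
  if height z < height x then inord 3 else inord 4.
have dirE (x : F k) : dir x = (if spine x < spine z then 0 else
  if spine z < spine x then 1 else if height x < height z then 2 else
  if height z < height x then 3 else 4) :> nat.
  by rewrite /dir; do ![case: ifP => _]; rewrite inordK.
rewrite -[5]card_ord -(@card_in_imset _ _ dir) ?max_card // => x y.
rewrite !inE !F_adjE /consec => xz yz /(congr1 val) /=; rewrite !dirE => exy.
case/orP: xz => [/eqP xz|xz]; case/orP: yz => [/eqP yz|yz].
- by rewrite xz yz.
- by subst x; apply: spine_height_inj; move: yz exy; do ![case: ifP]; lia.
- by subst y; apply: spine_height_inj; move: xz exy; do ![case: ifP]; lia.
- by apply: spine_height_inj; move: xz yz exy; do ![case: ifP]; lia.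
Qed.

End Fk.

(** * Asymptotic form of the bounds *)

Import Order.TTheory GRing.Theory Num.Theory.
Local Open Scope classical_set_scope.
Local Open Scope ring_scope.

Lemma natr_Theta_sqr (R : realType) (u : nat -> nat) (c1 c2 : nat) :
  (forall k, 0 < k -> k ^ 2 <= c1 * u k)%N ->
  (forall k, 0 < k -> u k <= c2 * k ^ 2)%N ->
  (fun k : nat => (u k)%:R : R^o) =Theta_\oo (fun k : nat => k%:R ^+ 2 : R^o).
Proof.
move=> lo up; rewrite eqThetaE; apply/asboolP.
(* At [k = 1] the lower bound reads [1 <= c1 * u 1]. *)
have c1_gt0 : (0 < c1)%N by have := lo 1%N isT; case: (c1).
(* The successor makes the upper constant positive even if [c2 = 0]. *)
exists (c1%:R^-1, c2.+1%:R); first by rewrite /= invr_gt0 !ltr0n c1_gt0.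
near=> k; have k0 : (0 < k)%N by near: k; exact: nbhs_infty_gt.
rewrite -natrX !normr_nat /= ler_pdivrMl ?ltr0n // -!natrM !ler_nat.
by split; [exact: lo | have := up k k0; nia].
Unshelve. all: by end_near.
Qed.

Theorem theorem4p8 (R : realType) :
  (fun k : nat => #|F k|%:R : R^o) =Theta_\oo (fun k : nat => k%:R ^+ 2 : R^o)
  /\ (fun k : nat => (bdim (F k))%:R : R^o) =O_\oo (fun k : nat => k%:R : R^o)
  /\ (fun k : nat => (adim (F k))%:R : R^o)
       =Theta_\oo (fun k : nat => k%:R ^+ 2 : R^o).
Proof.
split; [|split].
(* For [k > 0], [(k + 1) * (k + 2)] lies between [k ^ 2] and [6 * k ^ 2]. *)
- by apply: (@natr_Theta_sqr _ _ 2 3) => k k0; have := card_F k; nia.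
(* For [k > 0], [4 * k + 2 <= 6 * k]. *)
- apply/eqO_exP; exists 6%:R; first by rewrite ltr0n.
  near=> k; have k0 : (0 < k)%N by near: k; exact: nbhs_infty_gt.
  by rewrite !normr_nat -natrM ler_nat; have := bdim_F k; lia.
(* Doubling [#|F k| <= 5 * adim (F k) + 1] gives [k ^ 2 + 3 * k + 2 <= 10 * adim (F k) + 2]. *)
- apply: (@natr_Theta_sqr _ _ 10 3) => k k0; have := card_F k.
    by have := @adim_lower (F k) 5 (@F_closed_neighbourhood k); nia.
  by have := adim_le_card (F k); nia.
Unshelve. all: by end_near.
Qed.
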